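(* Let $f\in L^1(\mathbb R)$. Then the function $\lambda\mapsto Tf(\lambda)$ is uniformly continuous on $\mathbb R$.
   Context: The chirp transform of $f\in L^1(\mathbb R)$ is $Tf(\lambda)=\int_{\mathbb R}f(x)e^{-\pi i\lambda x^2}\,dx$, $\lambda\in\mathbb R$. *)

(* Defs.v *)
From mathcomp Require Import all_boot all_order all_algebra.
From mathcomp Require Import complex.
From mathcomp Require Import all_classical all_reals all_analysis.

Set Implicit Arguments.
Unset Strict Implicit.
Unset Printing Implicit Defensive.

Import Order.TTheory GRing.Theory Num.Theory.
Import numFieldNormedType.Exports.

Local Open Scope classical_set_scope.
Local Open Scope ring_scope.
Local Open Scope complex_scope.

Definition cexp (R : realType) (z : R[i]) : R[i] :=
  (expR (complex.Re z))%:C * (cos (complex.Im z) +i* sin (complex.Im z)).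

(* The Borel sigma-algebra of R[i] is that of R * R, so measurability of a
   complex function is measurability of its real and imaginary parts. *)
Definition cintegrable (d : measure_display) (T : measurableType d)
    (R : realType) (mu : {measure set T -> \bar R}) (f : T -> R[i]) : Prop :=
  [/\ measurable_fun setT (fun x => complex.Re (f x)),
      measurable_fun setT (fun x => complex.Im (f x)) &
      (\int[mu]_x (ComplexField.Normc.normc (f x))%:E < +oo)%E].

Definition cintegral (d : measure_display) (T : measurableType d)
    (R : realType) (mu : {measure set T -> \bar R}) (f : T -> R[i]) : R[i] :=
  (\int[mu]_x complex.Re (f x))%R +i* (\int[mu]_x complex.Im (f x))%R.

(* [lebesgue_measure] only measures Borel sets; its completion is used so that
   L^1 contains every Lebesgue-measurable representative.  The carrier of the
   domain of [completed_lebesgue_measure] is convertible to [R]. *)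
Definition L1 (R : realType) (f : R -> R[i]) : Prop :=
  cintegrable (@completed_lebesgue_measure R) f.

Definition chirp (R : realType) (f : R -> R[i]) (lambda : R) : R[i] :=
  cintegral (@completed_lebesgue_measure R)
    (fun x : R => f x * cexp (- (pi%:C * 'i%C * lambda%:C * x%:C ^+ 2))).

(* Main.v *)
Require Import Defs.
From mathcomp Require Import all_boot all_order all_algebra.
From mathcomp Require Import complex.
From mathcomp Require Import all_classical all_reals all_analysis.
From mathcomp Require Import measurable_realfun ring.

(* Since [cos] and [sin] are 1-Lipschitz and bounded by 1, the real and
   imaginary parts of [Tf l - Tf m] are at most a constant times
   [W (l - m)], where [W h] is the integral of [|f x| min(2, |h pi x^2|)].
   This modulus depends on [l - m] only, and tends to [W 0 = 0] as [h] tends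
   to [0] by dominated convergence (with dominating function [2 |f|]). *)

Set Implicit Arguments.
Unset Strict Implicit.
Unset Printing Implicit Defensive.

Import Order.TTheory GRing.Theory Num.Theory.
Import numFieldNormedType.Exports.

Local Open Scope classical_set_scope.
Local Open Scope ring_scope.
Local Open Scope complex_scope.

(** By the mean value theorem an increment of [k] is a value of [dk] times [b - a]; both sides are
    symmetric in [a] and [b]. *)
Lemma lipschitz1_derive (R : realType) (k dk : R -> R) :
  (forall x, is_derive x (1 : R) k (dk x)) -> (forall x, `|dk x| <= 1) ->
  forall a b, `|k a - k b| <= `|a - b|.
Proof.
move=> k_dk dk1 a b; wlog ab : a b / a <= b.
  move=> H; have /orP[/H//|/H] := le_total a b.
  by rewrite distrC (distrC b).
have [|x _ kab] := MVT_segment ab (fun x _ => k_dk x).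
  by apply: derivable_within_continuous => x _; have [] := k_dk x.
by rewrite distrC kab normrM (distrC a) ler_piMl.
Qed.

Section lipschitz_kernel.
Context d (T : measurableType d) (R : realType).
Variable mu : {measure set T -> \bar R}.
Implicit Types g p u v : T -> R.

Lemma integrable_bounded_mul g (k : T -> R) (c : R) :
  mu.-integrable setT (EFin \o g) -> measurable_fun setT k ->
  (forall x, `|k x| <= c) ->
  mu.-integrable setT (EFin \o (fun x => g x * k x)).
Proof.
move=> gi mk kc; have /measurable_EFinP mg := measurable_int _ gi.
apply: (@le_integrable _ _ _ mu _ measurableT _
  (fun x => c%:E * (EFin \o g) x)%E).
- by apply/measurable_EFinP; exact: measurable_funM.
- move=> x _ /=; rewrite lee_fin !normrM mulrC ler_wpM2r//.
  by rewrite (le_trans (kc x))// ler_norm.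
- exact: integrableZl.
Qed.

Lemma measurable_min_norm p h :
  measurable_fun setT p -> measurable_fun setT (fun x => Num.min 2 `|h * p x|).
Proof.
move=> mp; apply: measurable_minr => //; apply: measurableT_comp => //.
exact: measurable_funM.
Qed.

Lemma min_norm_le2 (a : R) : `|Num.min 2 `|a| | <= 2.
Proof. by rewrite ger0_norm ?le_min ?normr_ge0 ?ler0n// ge_min lexx. Qed.

Lemma modulus_small g p :
  mu.-integrable setT (EFin \o g) -> measurable_fun setT p ->
  forall e, 0 < e -> exists2 r, 0 < r & forall h, `|h| < r ->
  \int[mu]_x (`|g x| * Num.min 2 `|h * p x|) < e.
Proof.
move=> gi mp e e0; have gi' := integrable_norm gi.
pose w h x := `|g x| * Num.min 2 `|h * p x|.
pose W h := \int[mu]_x w h x.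
have cw x : continuous (w ^~ x : R^o -> R^o).
  have cp : continuous (fun l : R => `|l * p x| : R^o).
    by move=> h; apply: cvg_norm; apply: cvgM; [exact: cvg_id|exact: cvg_cst].
  have cm : continuous (fun l : R => Num.min 2 `|l * p x| : R^o).
    move=> h; have c2 : {for h, continuous (fun=> 2 : R^o)} by exact: cvg_cst.
    exact: continuous_min c2 (cp h).
  by move=> h; apply: cvgM; [exact: cvg_cst|exact: cm].
(* Any open interval around 0 would serve: the bound [|g x| * 2] on the integrand holds for every
   [h]. *)
have : {in `]-1, 1[%classic, continuous W}.
  apply: (@continuity_under_integral _ _ _ mu w _ measurableT _ _ _ _
    (fun x => `|g x| * 2)).
  - move=> h _; apply: (@integrable_bounded_mul _
      (fun x => Num.min 2 `|h * p x|) 2 gi' _ (fun x => min_norm_le2 _)).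
    exact: measurable_min_norm.
  - by apply: aeW => x _ h _; exact: cw.
  - apply: (@integrable_bounded_mul _ (cst 2) 2 gi') => [|x] /=.
      exact: measurable_cst.
    by rewrite ger0_norm.
  - move=> h _; apply: aeW => x _.
    by rewrite normrM normr_id ler_wpM2l//; exact: min_norm_le2.
move=> /(_ 0); rewrite inE/= in_itv/= oppr_lt0 ltr01 => /(_ isT).
have W0 : W 0 = 0.
  rewrite /W /w; under eq_Rintegral do rewrite mul0r normr0 min_r// mulr0.
  by rewrite Rintegral_cst// mul0r.
move/cvgrPdist_lt => /(_ _ e0)[r/= r0 rW]; exists r => // h hr.
have := rW h; rewrite /= W0 !sub0r !normrN => /(_ hr).
by apply: le_lt_trans; exact: ler_norm.
Qed.

(** With [k] abstract, one argument serves both [cos] and [sin]. As [p] may be unbounded, the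
    Lipschitz bound alone need not be integrable against [g]; the bound 2 takes over where [p] is
    large. *)
Lemma Rintegral_lipschitz_uniform g p (k : R -> R) :
  mu.-integrable setT (EFin \o g) -> measurable_fun setT p ->
  measurable_fun setT k -> (forall a, `|k a| <= 1) ->
  (forall a b, `|k a - k b| <= `|a - b|) ->
  forall e, 0 < e -> exists2 r, 0 < r & forall l m, `|l - m| < r ->
  `|\int[mu]_x (g x * k (l * p x)) - \int[mu]_x (g x * k (m * p x))| < e.
Proof.
move=> gi mp mk k1 klip e e0; have [r r0 rW] := modulus_small gi mp e0.
have mkp l : measurable_fun setT (fun x => k (l * p x)).
  by apply: measurableT_comp mk _; exact: measurable_funM.
have ik l : mu.-integrable setT (EFin \o (fun x => g x * k (l * p x))).
  exact: integrable_bounded_mul (fun x => k1 (l * p x)).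
exists r => // l m lmr; rewrite -RintegralB//; apply: le_lt_trans (rW _ lmr).
have iB : mu.-integrable setT
    (EFin \o (fun x => g x * k (l * p x) - g x * k (m * p x))).
  by have := integrableB measurableT (ik l) (ik m).
apply: le_trans (le_normr_Rintegral measurableT iB) _.
apply: le_Rintegral => //.
- exact: integrable_norm iB.
- exact: (@integrable_bounded_mul _ (fun x => Num.min 2 `|(l - m) * p x|) 2
    (integrable_norm gi) (measurable_min_norm _ mp) (fun x => min_norm_le2 _)).
(* The bound [|(l - m) * p x|] is the Lipschitz property; the bound 2 is the triangle inequality
   with [|k| <= 1]. *)
- move=> x _; rewrite -mulrBr normrM ler_wpM2l// le_min mulrBl klip andbT.
  by rewrite (le_trans (ler_normB _ _))// -[2]/(1 + 1) lerD.
Qed.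

(** Both parts of the chirp transform have this shape: [(u, v)] is (Re f, Im f) for the real part
    and (Im f, -Re f) for the imaginary part. *)
Lemma Rintegral_trig_uniform u v p :
  mu.-integrable setT (EFin \o u) -> mu.-integrable setT (EFin \o v) ->
  measurable_fun setT p ->
  forall e, 0 < e -> exists2 r, 0 < r & forall l m, `|l - m| < r ->
  `|\int[mu]_x (u x * cos (l * p x) + v x * sin (l * p x)) -
    \int[mu]_x (u x * cos (m * p x) + v x * sin (m * p x))| < e.
Proof.
move=> iu iv mp e e0; have e2 : 0 < e / 2 by rewrite divr_gt0.
have mcos := continuous_measurable_fun (@continuous_cos R).
have msin := continuous_measurable_fun (@continuous_sin R).
have dcos1 (x : R) : `|- sin x| <= 1 by rewrite normrN sin_max.
have coslip := lipschitz1_derive (@is_derive_cos R) dcos1.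
have sinlip := lipschitz1_derive (@is_derive_sin R) (@cos_max R).
have [r1 r10 H1] :=
  Rintegral_lipschitz_uniform iu mp mcos (@cos_max R) coslip e2.
have [r2 r20 H2] :=
  Rintegral_lipschitz_uniform iv mp msin (@sin_max R) sinlip e2.
exists (Num.min r1 r2); first by rewrite lt_min r10.
move=> l m; rewrite lt_min => /andP[/H1 h1 /H2 h2].
have mk (k : R -> R) a :
    measurable_fun setT k -> measurable_fun setT (fun x => k (a * p x)).
  by move=> mk; apply: measurableT_comp mk _; exact: measurable_funM.
have icos a : mu.-integrable setT (EFin \o (fun x => u x * cos (a * p x))).
  exact: integrable_bounded_mul iu (mk _ a mcos) (fun x => cos_max _).
have isin a : mu.-integrable setT (EFin \o (fun x => v x * sin (a * p x))).
  exact: integrable_bounded_mul iv (mk _ a msin) (fun x => sin_max _).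
rewrite !RintegralD// opprD addrACA (le_lt_trans (ler_normD _ _))//.
by rewrite [e]splitr ltrD.
Qed.

End lipschitz_kernel.

(** Preimages of Borel sets under [p] are Borel, and Borel sets are Caratheodory measurable. This
    carries Borel functions over to the domain of the completed measure. *)
Lemma completed_measurable (R : realType) (p : R -> R) :
  measurable_fun [set: measurableTypeR R] p ->
  measurable_fun setT (p : caratheodory_type (@wlength R idfun)^*%mu -> R).
Proof.
by move=> mp _ B mB; have := mp measurableT B mB; exact: sub_caratheodory.
Qed.

(** The exponent is purely imaginary, so the real exponential factor is 1. The phase is grouped as
    [a] times a function of [x] to fit the kernels [k (l * p x)]. *)
Lemma cexp_imag (R : realType) (a x : R) :
  cexp (- (pi%:C * 'i%C * a%:C * x%:C ^+ 2)) =
  cos (a * (pi * x ^+ 2)) +i* (- sin (a * (pi * x ^+ 2))).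
Proof.
have -> : - (pi%:C * 'i%C * a%:C * x%:C ^+ 2) =
    0 +i* (- (a * (pi * x ^+ 2))) :> R[i].
  rewrite expr2; apply/eqP; rewrite eq_complex /=.
  by apply/andP; split; apply/eqP; ring.
by rewrite /cexp /= expR0 mul1r cosN sinN.
Qed.

Lemma normc_le_ReIm (R : rcfType) (z : R[i]) :
  `|z| <= (`|complex.Re z| + `|complex.Im z|)%:C.
Proof.
case: z => a b /=; rewrite normc_def lecR /=.
rewrite -(@ler_pXn2r _ 2)// ?nnegrE ?addr_ge0 ?sqrtr_ge0//.
rewrite sqr_sqrtr ?addr_ge0 ?sqr_ge0// sqrrD !real_normK ?num_real//.
(* After squaring, the two sides differ by the cross term 2|a||b|, which is nonnegative. *)
by rewrite addrAC lerDl mulrn_wge0// mulr_ge0.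
Qed.

(** Both parts are dominated by the modulus, whose integral is finite; comparing the integrals uses
    that the modulus is measurable, as the square root of a measurable function. *)
Lemma cintegrable_ReIm d (T : measurableType d) (R : realType)
    (mu : {measure set T -> \bar R}) (f : T -> R[i]) :
  cintegrable mu f ->
  mu.-integrable setT (EFin \o (fun x => complex.Re (f x))) /\
  mu.-integrable setT (EFin \o (fun x => complex.Im (f x))).
Proof.
have normcE (z : R[i]) : ComplexField.Normc.normc z =
    Num.sqrt (complex.Re z ^+ 2 + complex.Im z ^+ 2) by case: z.
move=> [mRe mIm foo].
have mn : measurable_fun setT (fun x => ComplexField.Normc.normc (f x)).
  rewrite (funext (fun x => normcE (f x))).
  apply: measurableT_comp (continuous_measurable_fun (@sqrt_continuous R)) _.
  by apply: measurable_funD; exact: measurable_funX.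
have dominated (g : T -> R) : measurable_fun setT g ->
    (forall x, `|g x| <= ComplexField.Normc.normc (f x)) ->
    mu.-integrable setT (EFin \o g).
  move=> mg gf; apply/integrableP; split; first exact/measurable_EFinP.
  apply: le_lt_trans foo; apply: ge0_le_integral => //.
  - by apply/measurable_EFinP; exact: measurableT_comp.
  - exact/measurable_EFinP.
  - by move=> x _; rewrite lee_fin gf.
split; apply: dominated => // x;
  rewrite normcE -sqrtr_sqr ler_sqrt ?addr_ge0 ?sqr_ge0//.
  by rewrite lerDl sqr_ge0.
by rewrite lerDr sqr_ge0.
Qed.

Theorem proposition2 (R : realType) (f : R -> R[i]) (hf : L1 f) :
  unif_continuous (chirp f : R -> R[i]^o).
Proof.
(* The radii of balls live in [R] on the source and in [R[i]] on the target;
   a positive element of [R[i]] is a positive real. *)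
rewrite /unif_continuous -!entourage_from_ballE => A [e /= e0 eA].
case: e e0 eA => er ei /=; rewrite ltcE /= => /andP[/eqP -> er0] eA.
have [iRe iIm] := cintegrable_ReIm hf.
set mu := @completed_lebesgue_measure R in hf iRe iIm *.
pose p : caratheodory_type (@wlength R idfun)^*%mu -> R :=
  fun x : R => pi * x ^+ 2.
have mp : measurable_fun setT p.
  by apply: completed_measurable; exact: measurable_funM.
(* With f = a + ib and phase t, this expands (a + ib)(cos t - i sin t). *)
have chirpE l : chirp f l =
  (\int[mu]_x (complex.Re (f x) * cos (l * p x) +
               complex.Im (f x) * sin (l * p x))) +i*
  (\int[mu]_x (complex.Im (f x) * cos (l * p x) +
               - complex.Re (f x) * sin (l * p x))).
  rewrite /chirp /cintegral; congr (_ +i* _); apply: eq_Rintegral => x _;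
    rewrite cexp_imag /p; case: (f x) => a b /=; ring.
have iNRe : mu.-integrable setT (EFin \o (fun x => - complex.Re (f x))).
  by have := integrableN iRe.
(* Half of the radius goes to each of the real and imaginary parts, as |z| is at most |Re z| + |Im
   z|. *)
have e2 : 0 < er / 2 by rewrite divr_gt0.
have [r1 r10 H1] := Rintegral_trig_uniform iRe iIm mp e2.
have [r2 r20 H2] := Rintegral_trig_uniform iIm iNRe mp e2.
exists (Num.min r1 r2); first by rewrite /= lt_min r10.
move=> [l m] /=; rewrite -ball_normE /= lt_min => /andP[/H1 h1 /H2 h2].
apply: eA; rewrite /= -ball_normE /= !chirpE.
apply: (le_lt_trans (normc_le_ReIm _)).
by rewrite ltcR /= [er]splitr; exact: ltrD.
Qed.
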